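(* Let $X$ be an irreducible Markov chain with transition matrix $P$ and stationary distribution $\mu$ on the finite connected graph $G=(V,E)$, and consider its associated electric network. For all disjoint non-empty $A,B\subset V$, the capacity $$\operatorname{cap}(A,B)=\sum_{x\in A}\mu_x\,\mathbf P_x\{\tau_B<\tau_A\}$$ equals the effective conductance $C^{\text{eff}}_{AB}=1/R^{\text{eff}}_{AB}$ between the sets $A$ and $B$.
   Context: Graphs are finite, connected and undirected, and loops are allowed; $x\sim y$ means that $x$ and $y$ are joined by an edge, with $x\sim x$ exactly when $x$ has a loop. A Markov chain on $G=(V,E)$ has $P_{xy}>0$ if and only if $x\sim y$; it need not be reversible. $\mathbf P_x$ is the law of the chain started from $x$, and $\tau_A=\inf\{t>0:X(t)\in A\}$, similarly $\tau_B$. An electric network on $G$ consists of resistances $R_{xy}=R_{yx}>0$ and amplifier parameters $\lambda_{xy}>0$ with $\lambda_{yx}=1/\lambda_{xy}$ for $x\sim y$, with $\lambda_{xx}=1$ on loops. Put $C_{xy}=1/R_{xy}$, $\gamma_{xy}=\sqrt{\lambda_{xy}}=1/\gamma_{yx}$, $D_{xy}=\frac{2\gamma_{xy}}{1+\lambda_{xy}}C_{xy}=D_{yx}$. The network associated with the chain is the one with $D_{xy}=\sqrt{\mu_xP_{xy}\mu_yP_{yx}}$ and $\gamma_{xy}=\sqrt{\mu_xP_{xy}/(\mu_yP_{yx})}$ (so $\lambda_{xy}=\gamma_{xy}^2$ and $C_{xy}=D_{xy}(1+\lambda_{xy})/(2\gamma_{xy})$). Potentials $(u_x)_{x\in V}$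 and currents are related by $i_{xy}=D_{xy}(\gamma_{yx}u_x-\gamma_{xy}u_y)$. The incoming current to vertex $x$ is $i_x=\sum_{y\sim x}i_{xy}$; $x$ is free if $i_x=0$. For potentials prescribed on a nonempty set of vertices, with all others free, there is a unique solution $(u,i)$. For disjoint non-empty $A,B$, hold $A$ at constant potential $U_A$, $B$ at constant potential $U_B$, with all other vertices free, and put $i_A=\sum_{x\in A}i_x$. In the network associated with a chain there is a constant $R^{\text{eff}}_{AB}>0$, the effective resistance, with $U_A-U_B=R^{\text{eff}}_{AB}\, i_A$ for all $U_A,U_B\in\mathbb R$. *)

(* Defs.v *)
From HB Require Import structures.
From mathcomp Require Import all_boot all_order all_algebra.
From mathcomp Require Import all_classical all_reals all_analysis.

Set Implicit Arguments.
Unset Strict Implicit.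
Unset Printing Implicit Defensive.

Import Order.TTheory GRing.Theory Num.Theory.

Local Open Scope classical_set_scope.
Local Open Scope ring_scope.

(* A graph on V is given by its adjacency relation e; e x x means that x
   carries a loop. *)
Definition connected_graph (V : finType) (e : rel V) : Prop :=
  symmetric e /\ forall x y : V, connect e x y.

Section Chain.
Context {R : realType} {V : finType}.
Implicit Types (P : V -> V -> R) (mu : V -> R).

Definition transition_matrix P : Prop :=
  (forall x y, 0 <= P x y) /\ (forall x, \sum_(y : V) P x y = 1).

Definition supported_on (e : rel V) P : Prop :=
  forall x y, (0 < P x y) <-> e x y.

Fixpoint n_step P (n : nat) (x y : V) : R :=
  if n is m.+1 then \sum_(z : V) P x z * n_step P m z y else (x == y)%:R.

Definition irreducible P : Prop := forall x y, exists n, 0 < n_step P n x y.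

Definition stationary_distribution P mu : Prop :=
  [/\ forall x, 0 <= mu x,
      \sum_(x : V) mu x = 1
    & forall y, \sum_(x : V) mu x * P x y = mu y].

Section Process.
Context {d : measure_display} {Omega : measurableType d}.
Implicit Types (Pr : V -> probability Omega R) (X : nat -> Omega -> V).

Definition cylinder X (p : nat -> V) (n : nat) : set Omega :=
  [set w | forall k, (k <= n)%N -> X k w = p k].

(* Pr x is the law of the chain started from x. The Markov property is written
   in product form, so that no conditioning on null events occurs. *)
Definition markov_chain P Pr X : Prop :=
  [/\ forall t (S : set V), measurable (X t @^-1` S),
      forall x, Pr x [set w | X 0%N w = x] = 1%E
    & forall x (p : nat -> V) n,
        Pr x (cylinder X p n.+1) =
        (Pr x (cylinder X p n) * (P (p n) (p n.+1))%:E)%E].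

(* The infimum is taken over t > 0 (return times), and is +oo when A is never
   visited. *)
Definition hitting_time X (A : {set V}) (w : Omega) : \bar R :=
  ereal_inf [set (t%:R : R)%:E | t in [set t : nat | (0 < t)%N /\ X t w \in A]].

Definition capacity mu Pr X (A B : {set V}) : R :=
  \sum_(x in A)
    mu x * fine (Pr x [set w | (hitting_time X B w < hitting_time X A w)%E]).

End Process.
End Chain.

(* All data are only meaningful on pairs of adjacent vertices. *)
Record network (R : realType) (V : finType) (e : rel V) := Network {
  resistance : V -> V -> R;
  amplifier : V -> V -> R;
  resistance_gt0 : forall x y, e x y -> 0 < resistance x y;
  resistance_sym : forall x y, e x y -> resistance x y = resistance y x;
  amplifier_gt0 : forall x y, e x y -> 0 < amplifier x y;
  amplifier_inv : forall x y, e x y -> amplifier y x = (amplifier x y)^-1;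
  amplifier_loop : forall x, e x x -> amplifier x x = 1 }.

Section Network.
Context {R : realType} {V : finType} {e : rel V}.
Implicit Types (N : network R e) (u : V -> R) (A B : {set V}).

Definition conductance N (x y : V) : R := (resistance N x y)^-1.

Definition gamma N (x y : V) : R := Num.sqrt (amplifier N x y).

Definition Dcoef N (x y : V) : R :=
  2 * gamma N x y / (1 + amplifier N x y) * conductance N x y.

Definition current N u (x y : V) : R :=
  Dcoef N x y * (gamma N y x * u x - gamma N x y * u y).

Definition vertex_current N u (x : V) : R := \sum_(y | e x y) current N u x y.

Definition set_current N u A : R := \sum_(x in A) vertex_current N u x.

Definition held_at N A B (UA UB : R) u : Prop :=
  [/\ forall x, x \in A -> u x = UA,
      forall x, x \in B -> u x = UB
    & forall x, x \notin A :|: B -> vertex_current N u x = 0].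

Definition is_effective_resistance N A B (r : R) : Prop :=
  0 < r /\
  forall (UA UB : R) u, held_at N A B UA UB u ->
    UA - UB = r * set_current N u A.

(* xget returns 0 if no constant satisfies the defining property. When potentials
   solving the network exist for some UA <> UB, at most one constant does. *)
Definition effective_resistance N A B : R :=
  xget 0 [set r | is_effective_resistance N A B r].

Definition effective_conductance N A B : R := (effective_resistance N A B)^-1.

Definition associated_network (P : V -> V -> R) (mu : V -> R) N : Prop :=
  forall x y, e x y ->
    Dcoef N x y = Num.sqrt (mu x * P x y * (mu y * P y x)) /\
    gamma N x y = Num.sqrt (mu x * P x y / (mu y * P y x)).

End Network.

(* Main.v *)
Require Import Defs.
From HB Require Import structures.
From mathcomp Require Import all_boot all_order all_algebra.
From mathcomp Require Import all_classical all_reals all_analysis.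

Set Implicit Arguments.
Unset Strict Implicit.
Unset Printing Implicit Defensive.

Import Order.TTheory GRing.Theory Num.Theory.
Import numFieldNormedType.Exports.

Local Open Scope ring_scope.

(** In the associated network the square roots multiply out:
    [D_xy * gamma_yx = mu_y P_yx] and [D_xy * gamma_xy = mu_x P_xy], so that
    [i_xy = mu_y P_yx u_x - mu_x P_xy u_y].  Summing over the neighbours [y] of
    [x], stationarity of [mu] turns the first term into [mu_x u_x], and
    [i_x = mu_x (u_x - (P u)_x)] ([vertex_current_associated]).  As
    [mu > 0], the free vertices are exactly
    those where [u] is [P]-harmonic.

    Let [h_x] be the probability that the chain from [x], counting time 0,
    visits [B] before [A].  Conditioning on the first step shows that
    [(P h)_x = P_x(tau_B < tau_A)] for every [x], including [x] in [A] where the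
    return time counts ([mean_reach_first]); hence [h] is harmonic off [A] and
    [B], with values 0 on [A] and 1 on [B].  By the maximum principle on a
    connected graph ([harmonic_eq0]) the only potential with boundary values
    [U_A], [U_B] is [u = U_A + (U_B - U_A) h] ([held_atE]).  For [x] in [A] its
    current is [mu_x (U_A - U_B) (P h)_x], and summing over [A] gives
    [i_A = (U_A - U_B) cap(A, B)] ([set_current_held]).

    Finally [cap(A, B) > 0] ([capacity_gt0]), so [1 / cap(A, B)] is an effective
    resistance; it is the only one, as is seen from the potential with
    [U_A = 1], [U_B = 0].

    The first-step identity is obtained from the finite-dimensional
    distributions: [tau_B < tau_A] is the disjoint union over [m] of the events
    that the first visit to [A] or [B] takes place at time [m + 1] and in [B].
    Their probabilities satisfy a recursion in [m], and countable additivity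
    allows passing to the limit. *)

(** * Harmonic functions and the maximum principle *)

Definition harmonic_off (R : realType) (V : finType) (P : V -> V -> R)
    (S : {set V}) (u : V -> R) : Prop :=
  forall x, x \notin S -> u x = \sum_y P x y * u y.

(** If the maximum were positive it would be attained off [S], where [u] is an
    average of its values at the neighbours; so the set of maximum points is
    closed under adjacency, and by connectedness it reaches [S], where
    [u <= 0]. *)
Lemma harmonic_le0 (R : realType) (V : finType) (e : rel V) (P : V -> V -> R)
    (S : {set V}) (u : V -> R) :
  connected_graph e -> transition_matrix P -> supported_on e P ->
  S != finset.set0 -> harmonic_off P S u ->
  (forall x, x \in S -> u x <= 0) -> forall x, u x <= 0.
Proof.
move=> [_ e_conn] [P_ge0 P_sum1] Pe /set0Pn[s sS] u_harm uS x.
case: (Order.TotalTheory.arg_maxP (i0 := x) (P := xpredT) u) => // m _ m_arg.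
have m_max w : u w <= u m by exact: m_arg.
apply: le_trans (m_max x) _; rewrite leNgt; apply/negP => um_gt0.
have step y z : u y = u m -> e y z -> u z = u m.
  move=> uym eyz.
  have yS : y \notin S by apply/negP => /uS; rewrite uym leNgt um_gt0.
  (* A vanishing average of the nonnegative gaps to the maximum forces each gap
     of positive weight to vanish. *)
  have gap_sum : \sum_z P y z * (u m - u z) = 0.
    under eq_bigr do rewrite mulrBr.
    by rewrite sumrB -mulr_suml P_sum1 mul1r -u_harm// uym subrr.
  have gap_ge0 w : true -> 0 <= P y w * (u m - u w).
    by move=> _; rewrite mulr_ge0// subr_ge0 m_max.
  have /eqP := psumr_eq0P gap_ge0 gap_sum (isT : xpredT z).
  by rewrite mulf_eq0 (gt_eqF (proj2 (Pe y z) eyz)) /= subr_eq0 => /eqP.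
have reach p y : u y = u m -> path e y p -> u (last y p) = u m.
  elim: p y => //= z p IHp y uym /andP[eyz]; apply: IHp; exact: step eyz.
have /connectP[p mp s_last] := e_conn m s.
by have := uS s sS; rewrite s_last (reach p m)// leNgt um_gt0.
Qed.

Lemma harmonic_eq0 (R : realType) (V : finType) (e : rel V) (P : V -> V -> R)
    (S : {set V}) (u : V -> R) :
  connected_graph e -> transition_matrix P -> supported_on e P ->
  S != finset.set0 -> harmonic_off P S u ->
  (forall x, x \in S -> u x = 0) -> forall x, u x = 0.
Proof.
move=> eC PT Pe S0 u_harm uS x; apply: le_anti; apply/andP; split.
  by apply: (harmonic_le0 eC PT Pe S0 u_harm) => y /uS ->.
rewrite -oppr_le0.
apply: (harmonic_le0 (u := fun y => - u y) eC PT Pe S0) => [y yS|y /uS ->].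
  by rewrite u_harm// -sumrN; apply: eq_bigr => z _; rewrite mulrN.
by rewrite oppr0.
Qed.

Lemma harmonic_affine (R : realType) (V : finType) (P : V -> V -> R)
    (S : {set V}) (h : V -> R) (a b : R) :
  transition_matrix P -> harmonic_off P S h ->
  harmonic_off P S (fun x => a + b * h x).
Proof.
move=> [_ P_sum1] h_harm x xS; rewrite h_harm//.
under [RHS]eq_bigr do rewrite mulrDr mulrCA.
by rewrite big_split /= -mulr_suml P_sum1 mul1r -mulr_sumr.
Qed.

Lemma harmonic_sub (R : realType) (V : finType) (P : V -> V -> R)
    (S : {set V}) (u v : V -> R) :
  harmonic_off P S u -> harmonic_off P S v ->
  harmonic_off P S (fun x => u x - v x).
Proof.
move=> hu hv x xS; rewrite hu// hv// -sumrB.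
by apply: eq_bigr => y _; rewrite mulrBr.
Qed.

(** * Currents in the associated network *)

(** [mu] is also invariant under [P^n], so the mass of any point charged by [mu]
    spreads to every [y] reachable from it. *)
Lemma stationary_gt0 (R : realType) (V : finType) (P : V -> V -> R)
    (mu : V -> R) :
  transition_matrix P -> irreducible P -> stationary_distribution P mu ->
  forall x, 0 < mu x.
Proof.
move=> [P_ge0 _] P_irr [mu_ge0 mu_sum1 mu_stat] y.
have n_ge0 n x z : 0 <= n_step P n x z.
  elim: n x => [|n IHn] x /=; first exact: ler0n.
  by apply: sumr_ge0 => w _; rewrite mulr_ge0.
have mu_n n : \sum_x mu x * n_step P n x y = mu y.
  elim: n => [|n IHn] /=.
    rewrite (bigD1 y)//= eqxx mulr1 big1 ?addr0// => x xy.
    by rewrite (negbTE xy) mulr0.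
  under eq_bigr do rewrite mulr_sumr.
  rewrite exchange_big/= -IHn; apply: eq_bigr => z _.
  by rewrite -[in RHS]mu_stat mulr_suml; apply: eq_bigr => x _; rewrite mulrA.
have [x mu_x] : exists x, mu x != 0.
  case: (pickP (fun x => mu x != 0)) => [x mu_x|mu0]; first by exists x.
  move: mu_sum1; rewrite big1 => [/eqP|x _]; first by rewrite eq_sym oner_eq0.
  exact/eqP/negbFE/mu0.
have [n n_gt0] := P_irr x y.
rewrite -(mu_n n) (bigD1 x)//=; apply: ltr_wpDr.
  by apply: sumr_ge0 => z _; rewrite mulr_ge0.
by rewrite mulr_gt0// lt0r mu_x mu_ge0.
Qed.

(** Kirchhoff's law for the network becomes harmonicity for the chain; see the
    introduction for the computation. *)
Lemma vertex_current_associated (R : realType) (V : finType) (e : rel V)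
    (P : V -> V -> R) (mu : V -> R) (N : network R e) (u : V -> R) (x : V) :
  connected_graph e -> transition_matrix P -> supported_on e P ->
  (forall y, 0 < mu y) -> stationary_distribution P mu ->
  associated_network P mu N ->
  vertex_current N u x = mu x * (u x - \sum_y P x y * u y).
Proof.
move=> [e_sym _] [P_ge0 _] Pe mu_gt0 [_ _ mu_stat] N_assoc.
have P_eq0 y z : ~~ e y z -> P y z = 0.
  move=> /negP eyz; apply/eqP; rewrite eq_le P_ge0 andbT leNgt.
  by apply/negP => /(proj1 (Pe y z)).
have sqrt_cancel (a b : R) : 0 < a -> 0 < b ->
    Num.sqrt (a * b) * Num.sqrt (a / b) = a.
  move=> a_gt0 b_gt0; rewrite -sqrtrM ?mulr_ge0 ?ltW//.
  rewrite mulrACA divff ?gt_eqF// mulr1 -expr2 sqrtr_sqr gtr0_norm//.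
have currentE y : e x y ->
    current N u x y = mu y * P y x * u x - mu x * P x y * u y.
  move=> exy; have eyx : e y x by rewrite e_sym.
  have fxy : 0 < mu x * P x y by rewrite mulr_gt0//; apply/Pe.
  have fyx : 0 < mu y * P y x by rewrite mulr_gt0//; apply/Pe.
  have [Dxy gxy] := N_assoc x y exy; have [_ gyx] := N_assoc y x eyx.
  rewrite /current Dxy gxy gyx.
  move: (mu x * P x y) (mu y * P y x) fxy fyx => a b a_gt0 b_gt0.
  by rewrite mulrBr !mulrA [in X in X - _](mulrC a) !sqrt_cancel.
rewrite /vertex_current (eq_bigr _ currentE) sumrB -mulr_suml.
(* [P] vanishes off the edges, so sums over neighbours are sums over [V]. *)
have sum_adj (F : V -> R) :
    (forall y, ~~ e x y -> F y = 0) -> \sum_(y | e x y) F y = \sum_y F y.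
  move=> F0; rewrite [RHS](bigID (e x))/= [X in _ + X]big1 ?addr0// => y; exact: F0.
rewrite sum_adj => [|y exy]; last by rewrite P_eq0 1?e_sym// mulr0.
rewrite sum_adj => [|y exy]; last by rewrite P_eq0// mulr0 mul0r.
rewrite mu_stat mulrBr mulr_sumr; congr (_ - _).
by apply: eq_bigr => y _; rewrite mulrA.
Qed.

(** * The probability of visiting [B] before [A] *)

Local Open Scope classical_set_scope.

(** The probability, from [x], that the first visit to [A] or [B] at a positive
    time takes place at time [m + 1] and in [B]. *)
Fixpoint first_entrance (R : realType) (V : finType) (P : V -> V -> R)
    (A B : {set V}) (m : nat) (x : V) : R :=
  if m is k.+1 then
    \sum_(y | y \notin finset.setU A B) P x y * first_entrance P A B k y
  else \sum_(y in B) P x y.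

(** The event that, after time [n], the first visit to [A] or [B] takes place at
    time [n + m + 1] and in [B].  The starting time [n] is a parameter because
    the law of the chain is only given through paths from time 0: the recursion
    on [m] moves [n] forward along such a path. *)
Definition enters (V : finType) (Omega : Type) (X : nat -> Omega -> V)
    (A B : {set V}) (n m : nat) : set Omega :=
  [set w | (forall k, (n < k <= n + m)%N -> X k w \notin finset.setU A B) /\
           X (n + m).+1 w \in B].

Lemma hitting_time_lt (R : realType) (V : finType) (d : measure_display)
    (Omega : measurableType d) (X : nat -> Omega -> V) (A B : {set V}) :
  [disjoint A & B]%B ->
  [set w | (hitting_time (R := R) X B w < hitting_time (R := R) X A w)%E] =
  \bigcup_m enters X A B 0 m.
Proof.
move=> AB; apply/seteqP; split=> w /=.
  move=> /ereal_inf_lt[_ [t [t_gt0 tB] <-] t_lt].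
  (* The earliest positive time spent in [B]; no visit to [A] precedes it. *)
  have ex_B : exists t, (0 < t)%N && (X t w \in B) by exists t; rewrite t_gt0.
  case: (ex_minnP ex_B) => -[//|m] /andP[_ mB] m_min; exists m => //; split=> //.
  move=> k /andP[k_gt0 km]; rewrite inE negb_or; apply/andP; split.
    apply/negP => kA; move: t_lt; rewrite ltNge => /negP; apply.
    apply: le_trans (_ : ((k%:R : R)%:E <= _)%E).
      by apply: ereal_inf_lbound; exists k.
    rewrite lee_fin ler_nat (leq_trans km)// ltnW//; apply: m_min.
    by rewrite t_gt0.
  apply/negP => kB; move: km; rewrite leqNgt => /negP; apply.
  by rewrite add0n; apply: m_min; rewrite k_gt0.
move=> [m _ [avoid mB]]; rewrite add0n in mB.
apply: le_lt_trans (_ : (_ <= (m.+1%:R : R)%:E)%E) _.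
  by apply: ereal_inf_lbound; exists m.+1.
(* Up to time [m + 1] the set [A] is not visited, so [tau_A >= m + 2]. *)
apply: lt_le_trans (_ : ((m.+2%:R : R)%:E <= _)%E).
  by rewrite lte_fin ltr_nat.
apply: le_ereal_inf_tmp => _ [k [k_gt0 kA] <-]; rewrite lee_fin ler_nat ltnNge.
rewrite leq_eqVlt ltnS; apply/negP => /orP[/eqP km|km].
  by move: (disjointFr AB kA); rewrite km mB.
by have := avoid k; rewrite k_gt0 add0n km inE kA => /(_ isT).
Qed.

Lemma trivIset_enters (V : finType) (Omega : Type) (X : nat -> Omega -> V)
    (A B : {set V}) (n : nat) : trivIset setT (enters X A B n).
Proof.
have before i j w : (i < j)%N -> enters X A B n i w -> ~ enters X A B n j w.
  move=> ij [_ iB] [avoid _].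
  have := avoid (n + i).+1.
  by rewrite ltnS leq_addr ltn_add2l ij inE iB orbT => /(_ isT).
apply/trivIsetP => i j _ _; rewrite neq_ltn => /orP[] ij; apply/seteqP; split=> w //.
  by move=> [wi wj]; exact: before ij wi wj.
by move=> [wi wj]; exact: before ij wj wi.
Qed.

Lemma measurable_cylinder (V : finType) (d : measure_display)
    (Omega : measurableType d) (X : nat -> Omega -> V) (p : nat -> V) (n : nat) :
  (forall t (S : set V), measurable (X t @^-1` S)) -> measurable (cylinder X p n).
Proof.
move=> mX.
rewrite (_ : cylinder X p n = \bigcap_(k in `I_n.+1) X k @^-1` [set p k]).
  by apply: bigcap_measurableType => k _; exact: mX.
by apply/seteqP; split=> w wp k; exact: wp.
Qed.

Lemma measurable_enters (V : finType) (d : measure_display)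
    (Omega : measurableType d) (X : nat -> Omega -> V) (A B : {set V}) (n m : nat) :
  (forall t (S : set V), measurable (X t @^-1` S)) ->
  measurable (enters X A B n m).
Proof.
move=> mX.
rewrite (_ : enters X A B n m =
  (\bigcap_(k in [set k | (n < k <= n + m)%N])
     X k @^-1` [set y | y \notin finset.setU A B]) `&`
  X (n + m).+1 @^-1` [set y | y \in B]).
  apply: measurableI; last exact: mX.
  by apply: bigcap_measurableType => k _; exact: mX.
by apply/seteqP; split=> w [avoid mB]; split=> // k; exact: avoid.
Qed.

Lemma measure_fiberwise (R : realType) (V : finType) (d : measure_display)
    (Omega : measurableType d) (m : {measure set Omega -> \bar R})
    (f : Omega -> V) (F : set Omega) :
  (forall y, measurable (f @^-1` [set y])) -> measurable F ->
  m F = (\sum_y m (F `&` f @^-1` [set y]))%E.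
Proof.
move=> mf mF.
have {1}-> : F = \bigcup_(y in [set: V]) (F `&` f @^-1` [set y]).
  apply/seteqP; split=> w; last by move=> [y _ []].
  by move=> Fw; exists (f w).
have setTE : [set: V] = [set` index_enum V].
  by apply/seteqP; split=> y //= _; rewrite mem_index_enum.
rewrite measure_fin_bigcup.
- by rewrite setTE -fsbig_seq// index_enum_uniq.
- exact: finite_finset.
- apply/trivIsetP => i j _ _ /eqP ij; apply/seteqP; split=> w //.
  by move=> [[_ /= fi] [_ /= fj]]; apply: ij; rewrite -fi.
- by move=> y _; apply: measurableI.
Qed.

Lemma probability_initial (R : realType) (V : finType) (d : measure_display)
    (Omega : measurableType d) (Q : probability Omega R) (f : Omega -> V)
    (x : V) (F : set Omega) :
  (forall y, measurable (f @^-1` [set y])) -> measurable F ->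
  Q (f @^-1` [set x]) = 1%E -> Q F = Q (F `&` f @^-1` [set x]).
Proof.
move=> mf mF Qx; rewrite (measure_fiberwise Q mf mF) (bigD1 x)//= big1 ?adde0//.
move=> y yx; apply/eqP; rewrite eq_le measure_ge0 andbT.
apply: (@le_trans _ _ (Q (~` (f @^-1` [set x])))).
  apply: le_measure; rewrite ?inE; [exact: measurableI|exact: measurableC|].
  by move=> w [_ /= fy] fx; move: yx; rewrite -fy -fx eqxx.
by rewrite probability_setC// Qx subee.
Qed.

Definition extend_path (V : finType) (p : nat -> V) (n : nat) (y : V) (k : nat) : V :=
  if k == n.+1 then y else p k.

Lemma cylinder_extend_path (V : finType) (d : measure_display)
    (Omega : measurableType d) (X : nat -> Omega -> V) (p : nat -> V) (n : nat)
    (y : V) :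
  cylinder X (extend_path p n y) n.+1 =
  cylinder X p n `&` X n.+1 @^-1` [set y].
Proof.
rewrite /cylinder /extend_path; apply/seteqP; split=> w /=.
  move=> wp; split; last by rewrite wp// eqxx.
  by move=> k kn; rewrite wp ?ltn_eqF// ltnW.
move=> [wp wy] k; rewrite leq_eqVlt => /orP[/eqP->|kn]; first by rewrite eqxx.
by rewrite ltn_eqF// wp.
Qed.

(** The Markov property at time [n], for the events [enters]: split according to
    the value [y] of [X_{n+1}] and induct on [m], the path [p] being prolonged
    by [y]. *)
Lemma cylinder_enters (R : realType) (V : finType) (P : V -> V -> R)
    (d : measure_display) (Omega : measurableType d)
    (Pr : V -> probability Omega R) (X : nat -> Omega -> V) (A B : {set V})
    (x : V) (p : nat -> V) (n m : nat) :
  markov_chain P Pr X ->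
  Pr x (cylinder X p n `&` enters X A B n m) =
  (Pr x (cylinder X p n) * (first_entrance P A B m (p n))%:E)%E.
Proof.
move=> [mX _ PrS].
have mXy t y : measurable (X t @^-1` [set y]) by exact: mX.
have PrX q k y : Pr x (cylinder X q k `&` X k.+1 @^-1` [set y]) =
    (Pr x (cylinder X q k) * (P (q k) y)%:E)%E.
  rewrite -cylinder_extend_path PrS /extend_path eqxx ltn_eqF//; congr (Pr x _ * _)%E.
  apply/seteqP; split=> w wq j jk; rewrite wq//.
    by rewrite ltn_eqF.
  by rewrite ltn_eqF.
have Pr_fin q k : Pr x (cylinder X q k) \is a fin_num.
  by apply: fin_num_measure; exact: measurable_cylinder.
elim: m n p => [|m IHm] n p /=; rewrite (measure_fiberwise _ (mXy n.+1)); try by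
  apply: measurableI; [exact: measurable_cylinder|exact: measurable_enters].
- rewrite -(fineK (Pr_fin p n)) -EFinM mulr_sumr -sumEFin [RHS]big_mkcond/=.
  apply: eq_bigr => y _; case: ifPn => yB.
    rewrite EFinM fineK// -PrX; congr (Pr x _).
    apply/seteqP; split=> w /=; first by move=> [[]].
    move=> [wp wy]; split=> //; split=> //; split; last by rewrite addn0 wy.
    by move=> k; rewrite addn0 => /andP[/leq_trans/[apply]]; rewrite ltnn.
  rewrite (_ : _ `&` _ = set0) ?measure0//; apply/seteqP; split=> w //=.
  by move=> [[_ [_]]]; rewrite addn0 => + wy; rewrite wy (negbTE yB).
- rewrite -(fineK (Pr_fin p n)) -EFinM mulr_sumr -sumEFin [RHS]big_mkcond/=.
  apply: eq_bigr => y _; case: ifPn => yAB.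
    transitivity (Pr x (cylinder X (extend_path p n y) n.+1 `&`
                        enters X A B n.+1 m)).
      rewrite cylinder_extend_path; congr (Pr x _); apply/seteqP; split=> w /=.
        move=> [[wp [avoid wB]] wy]; do 2?split=> //; last by rewrite addSnnS.
        by move=> k /andP[nk km]; apply: avoid; rewrite ltnW//= -addSnnS.
      move=> [[wp wy] [avoid wB]]; split=> //; split=> //; split; last by rewrite -addSnnS.
      move=> k /andP[]; rewrite leq_eqVlt => /orP[/eqP<- _|nk km].
        by rewrite wy.
      by apply: avoid; rewrite nk addSnnS.
    rewrite IHm cylinder_extend_path PrX /extend_path eqxx.
    by rewrite -(fineK (Pr_fin p n)) -!EFinM mulrA.
  rewrite (_ : _ `&` _ = set0) ?measure0//; apply/seteqP; split=> w //=.
  move=> [[_ [avoid _]] wy]; have := avoid n.+1.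
  by rewrite ltnSn -addSnnS leq_addr wy (negbTE yAB) => /(_ isT).
Qed.

(** [P_x(tau_B < tau_A)]; for [x] in [A] this is the probability of escaping to
    [B] before returning to [A], which appears in [capacity]. *)
Definition escape (R : realType) (V : finType) (d : measure_display)
    (Omega : measurableType d) (Pr : V -> probability Omega R)
    (X : nat -> Omega -> V) (A B : {set V}) (x : V) : R :=
  fine (Pr x [set w | (hitting_time (R := R) X B w < hitting_time (R := R) X A w)%E]).

Lemma escape_series (R : realType) (V : finType) (P : V -> V -> R)
    (d : measure_display) (Omega : measurableType d)
    (Pr : V -> probability Omega R) (X : nat -> Omega -> V) (A B : {set V})
    (x : V) :
  markov_chain P Pr X -> [disjoint A & B]%B ->
  (fun n => \sum_(0 <= m < n) first_entrance P A B m x) @ \oo -->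
  escape Pr X A B x.
Proof.
move=> mc AB; have [mX PrX0 _] := mc.
have mE m : measurable (enters X A B 0 m) by exact: measurable_enters.
have PrE m : Pr x (enters X A B 0 m) = (first_entrance P A B m x)%:E.
  have cyl0 : cylinder X (fun=> x) 0 = X 0%N @^-1` [set x].
    by apply/seteqP; split=> w /=; [exact|move=> wx k; rewrite leqn0 => /eqP->].
  rewrite (probability_initial (fun y => mX 0%N [set y]) (mE m) (PrX0 x)).
  rewrite setIC -cyl0 (cylinder_enters _ _ _ _ _ _ mc) cyl0.
  by rewrite [X in (X * _)%E]PrX0 mul1e.
have mU : measurable (\bigcup_m enters X A B 0 m) by exact: bigcup_measurable.
have /fine_cvg : (fun n => (\sum_(0 <= m < n) Pr x (enters X A B 0 m))%E) @ \oo
    --> (escape Pr X A B x)%:E.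
  rewrite /escape hitting_time_lt// fineK ?fin_num_measure//.
  by apply: measure_sigma_additive; [exact: mE|exact: trivIset_enters].
apply: cvg_trans; apply: near_eq_cvg; near=> n => /=.
by under eq_bigr do rewrite PrE; rewrite sumEFin.
Unshelve. all: by end_near. Qed.

(** The partial sums of the series for [escape] satisfy the first-step identity
    with the time horizon lowered by one on the right; let it tend to
    infinity. *)
Lemma escape_first_step (R : realType) (V : finType) (P : V -> V -> R)
    (d : measure_display) (Omega : measurableType d)
    (Pr : V -> probability Omega R) (X : nat -> Omega -> V) (A B : {set V})
    (x : V) :
  markov_chain P Pr X -> [disjoint A & B]%B ->
  escape Pr X A B x = \sum_(y in B) P x y +
    \sum_(y | y \notin finset.setU A B) P x y * escape Pr X A B y.
Proof.
move=> mc AB; have ser y := escape_series (x := y) mc AB.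
have ser_step : (fun n => \sum_(0 <= m < n.+1) first_entrance P A B m x) @ \oo -->
    \sum_(y in B) P x y +
    \sum_(y | y \notin finset.setU A B) P x y * escape Pr X A B y.
  under eq_fun => n do rewrite big_nat_recl//= exchange_big/=.
  apply: cvgD; first exact: cvg_cst.
  apply: (cvg_big add_continuous) => y _.
  under eq_fun => n do rewrite -mulr_sumr.
  by apply: cvgM; [exact: cvg_cst|exact: ser].
have serS := ser x; rewrite -cvg_shiftS in serS.
by apply: (cvg_unique _ serS ser_step); exact: norm_hausdorff.
Qed.

Local Close Scope classical_set_scope.

(** The probability of visiting [B] before [A] when time 0 counts.  It differs
    from [escape] on [A] and [B] only, where it takes the boundary values of the
    Dirichlet problem. *)
Definition reach_first (R : realType) (V : finType) (d : measure_display)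
    (Omega : measurableType d) (Pr : V -> probability Omega R)
    (X : nat -> Omega -> V) (A B : {set V}) (x : V) : R :=
  if x \in B then 1 else if x \in A then 0 else escape Pr X A B x.

(** After one step of the chain, the hitting times from positive time on become
    hitting times from time 0 on.  This holds for [x] in [A] and in [B] too,
    which is what links the current at [A] to the capacity. *)
Lemma mean_reach_first (R : realType) (V : finType) (P : V -> V -> R)
    (d : measure_display) (Omega : measurableType d)
    (Pr : V -> probability Omega R) (X : nat -> Omega -> V) (A B : {set V})
    (x : V) :
  markov_chain P Pr X -> [disjoint A & B] ->
  \sum_y P x y * reach_first Pr X A B y = escape Pr X A B x.
Proof.
move=> mc AB; rewrite (escape_first_step x mc AB) (bigID (mem B))/=; congr (_ + _).
  by apply: eq_bigr => y yB; rewrite /reach_first yB mulr1.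
rewrite big_mkcond [RHS]big_mkcond/=; apply: eq_bigr => y _.
rewrite /reach_first inE negb_or.
by case: (y \in B) => /=; case: (y \in A); rewrite /= ?mulr0.
Qed.

Lemma reach_first_harmonic (R : realType) (V : finType) (P : V -> V -> R)
    (d : measure_display) (Omega : measurableType d)
    (Pr : V -> probability Omega R) (X : nat -> Omega -> V) (A B : {set V}) :
  markov_chain P Pr X -> [disjoint A & B] ->
  harmonic_off P (A :|: B) (reach_first Pr X A B).
Proof.
move=> mc AB x; rewrite inE negb_or => /andP[xA xB].
by rewrite (mean_reach_first x mc AB) /reach_first (negbTE xA) (negbTE xB).
Qed.

(** * Potentials, currents and capacity *)

(** Both sides are harmonic off [A] and [B] with the same boundary values. *)
Lemma held_atE (R : realType) (V : finType) (e : rel V)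
    (P : V -> V -> R) (mu : V -> R) (d : measure_display)
    (Omega : measurableType d) (Pr : V -> probability Omega R)
    (X : nat -> Omega -> V) (N : network R e) (A B : {set V})
    (UA UB : R) (u : V -> R) :
  connected_graph e -> transition_matrix P -> supported_on e P ->
  (forall y, 0 < mu y) -> stationary_distribution P mu ->
  markov_chain P Pr X -> associated_network P mu N ->
  B != finset.set0 -> [disjoint A & B] ->
  held_at N A B UA UB u <->
  forall x, u x = UA + (UB - UA) * reach_first Pr X A B x.
Proof.
move=> eC PT Pe mu_gt0 mu_stat mc N_assoc B0 AB.
pose h x := UA + (UB - UA) * reach_first Pr X A B x.
have h_harm : harmonic_off P (A :|: B) h.
  by apply: harmonic_affine => //; exact: reach_first_harmonic.
have hA x : x \in A -> h x = UA.
  by move=> xA; rewrite /h /reach_first (disjointFr AB xA) xA mulr0 addr0.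
have hB x : x \in B -> h x = UB.
  by move=> xB; rewrite /h /reach_first xB mulr1 addrC subrK.
have vcE := vertex_current_associated _ _ eC PT Pe mu_gt0 mu_stat N_assoc.
split=> [[uA uB u_free] x|uh].
  have u_harm : harmonic_off P (A :|: B) u.
    move=> y /u_free; rewrite vcE => /eqP.
    by rewrite mulf_eq0 gt_eqF//= subr_eq0 => /eqP.
  apply/eqP; rewrite -subr_eq0; apply/eqP; rewrite -/(h x).
  apply: (harmonic_eq0 eC PT Pe _ (harmonic_sub u_harm h_harm)) => [|y].
    have /set0Pn[b bB] := B0.
    by apply/set0Pn; exists b; rewrite inE bB orbT.
  by rewrite inE => /orP[yA|yB]; [rewrite uA// hA|rewrite uB// hB]; rewrite ?subrr.
split=> [x xA|x xB|x xAB]; rewrite ?vcE.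
- by rewrite uh -/(h x) hA.
- by rewrite uh -/(h x) hB.
- under eq_bigr do rewrite uh.
  by rewrite uh -/(h x) h_harm// subrr mulr0.
Qed.

(** On [A] the potential is [UA] and its average over the next step is
    [UA + (UB - UA) * escape], so the current is [(UA - UB) * mu * escape]. *)
Lemma set_current_held (R : realType) (V : finType) (e : rel V)
    (P : V -> V -> R) (mu : V -> R) (d : measure_display)
    (Omega : measurableType d) (Pr : V -> probability Omega R)
    (X : nat -> Omega -> V) (N : network R e) (A B : {set V})
    (UA UB : R) (u : V -> R) :
  connected_graph e -> transition_matrix P -> supported_on e P ->
  (forall y, 0 < mu y) -> stationary_distribution P mu ->
  markov_chain P Pr X -> associated_network P mu N ->
  B != finset.set0 -> [disjoint A & B] ->
  held_at N A B UA UB u ->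
  set_current N u A = (UA - UB) * capacity mu Pr X A B.
Proof.
move=> eC PT Pe mu_gt0 mu_stat mc N_assoc B0 AB u_held; have [uA _ _] := u_held.
have uE := proj1 (held_atE UA UB u eC PT Pe mu_gt0 mu_stat mc N_assoc B0 AB) u_held.
rewrite /set_current /capacity mulr_sumr; apply: eq_bigr => x xA.
rewrite (vertex_current_associated _ _ eC PT Pe mu_gt0 mu_stat N_assoc) uA//.
under eq_bigr do rewrite uE mulrDr mulrCA.
rewrite big_split/= -mulr_suml (proj2 PT) mul1r -mulr_sumr mean_reach_first//.
by rewrite opprD addNKr -mulNr opprB mulrCA.
Qed.

(** If the capacity vanished, [P h = 0 = h] on [A], so [h] would be harmonic
    everywhere off [B]; being 1 on [B] it would be 1 everywhere, whereas it is 0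
    on [A]. *)
Lemma capacity_gt0 (R : realType) (V : finType) (e : rel V)
    (P : V -> V -> R) (mu : V -> R) (d : measure_display)
    (Omega : measurableType d) (Pr : V -> probability Omega R)
    (X : nat -> Omega -> V) (A B : {set V}) :
  connected_graph e -> transition_matrix P -> supported_on e P ->
  (forall y, 0 < mu y) -> markov_chain P Pr X ->
  A != finset.set0 -> B != finset.set0 -> [disjoint A & B] ->
  0 < capacity mu Pr X A B.
Proof.
move=> eC PT Pe mu_gt0 mc /set0Pn[a aA] B0 AB.
have term_ge0 x : x \in A -> 0 <= mu x * escape Pr X A B x.
  by move=> _; apply: mulr_ge0; [exact: ltW|exact: fine_ge0].
rewrite lt0r sumr_ge0// andbT; apply/negP => /eqP cap0.
have g0 x : x \in A -> escape Pr X A B x = 0.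
  move=> xA; apply/eqP; have /eqP := psumr_eq0P term_ge0 cap0 xA.
  by rewrite mulf_eq0 gt_eqF.
have h_harm : harmonic_off P B (reach_first Pr X A B).
  move=> x xB; rewrite (mean_reach_first x mc AB) /reach_first (negbTE xB).
  by case: ifP => // /g0.
have hB x : x \in B -> 1 + (-1) * reach_first Pr X A B x = 0.
  by move=> xB; rewrite /reach_first xB mulr1 subrr.
have := harmonic_eq0 eC PT Pe B0 (harmonic_affine 1 (-1) PT h_harm) hB a.
rewrite /reach_first (disjointFr AB aA) aA mulr0 addr0 => /eqP.
by rewrite oner_eq0.
Qed.

Theorem proposition3p9 (R : realType) (V : finType) (e : rel V)
    (P : V -> V -> R) (mu : V -> R)
    (d : measure_display) (Omega : measurableType d)
    (Pr : V -> probability Omega R) (X : nat -> Omega -> V)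
    (N : network R e) (A B : {set V}) :
  connected_graph e ->
  transition_matrix P ->
  supported_on e P ->
  irreducible P ->
  stationary_distribution P mu ->
  markov_chain P Pr X ->
  associated_network P mu N ->
  A != finset.set0 -> B != finset.set0 -> [disjoint A & B] ->
  capacity mu Pr X A B = effective_conductance N A B.
Proof.
move=> eC PT Pe P_irr mu_stat mc N_assoc A0 B0 AB.
have mu_gt0 := stationary_gt0 PT P_irr mu_stat.
have cap_gt0 := capacity_gt0 eC PT Pe mu_gt0 mc A0 B0 AB.
have cap_neq0 : capacity mu Pr X A B != 0 by rewrite gt_eqF.
have iA UA UB u := @set_current_held _ _ _ _ _ _ _ _ _ _ _ _ UA UB u
  eC PT Pe mu_gt0 mu_stat mc N_assoc B0 AB.
have cap_res : is_effective_resistance N A B (capacity mu Pr X A B)^-1.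
  split=> [|UA UB u /iA ->]; first by rewrite invr_gt0.
  by rewrite mulrCA mulVf ?mulr1.
have res_uniq r : is_effective_resistance N A B r -> r = (capacity mu Pr X A B)^-1.
  pose u x := 1 + (0 - 1) * reach_first Pr X A B x.
  have u_held : held_at N A B 1 0 u.
    exact: (proj2 (held_atE 1 0 u eC PT Pe mu_gt0 mu_stat mc N_assoc B0 AB)).
  move=> [_ /(_ _ _ _ u_held)]; rewrite (iA _ _ _ u_held) subr0 mul1r => r_cap.
  by apply: (mulIf cap_neq0); rewrite mulVf// -r_cap.
rewrite /effective_conductance /effective_resistance.
by rewrite (xget_unique _ cap_res res_uniq) invrK.
Qed.
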